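(* Let $n\ge 1$ and let $B_n$ be the set of standard domino tableaux with $n$ dominoes whose shape has at most two rows. For $T\in B_n$ let $S_T\subseteq[n]=\{1,\dots,n\}$ be the set of labels of the dominoes that lie horizontally in the first row of $T$. Then the map $T\mapsto S_T$ is a bijection from $B_n$ to the set of all subsets of $[n]$; in particular each $T\in B_n$ is uniquely determined by the set of labels of dominoes lying horizontally in its first row. Consequently, for each $0\le k\le n$ there are exactly $\binom{n}{k}$ elements of $B_n$ having exactly $k$ dominoes lying horizontally in the first row.
   Context: A partition $\lambda=(\lambda_1\ge\lambda_2\ge\dots)$ of $2n$ determines an upper-left-justified (English convention) Young diagram with $\lambda_i$ boxes in row $i$. A domino diagram of shape $\lambda\vdash 2n$ is a tiling of this diagram by $n$ non-overlapping dominoes, each a $1\times 2$ (horizontal) or $2\times 1$ (vertical) rectangle of boxes. A standard domino tableau (SDT) is such a tiling in which the dominoes are labeled bijectively by $1,2,\dots,n$ so that labels increase from left to right along rows and from top to bottom down columns (equivalently, for every $i$, the dominoes labeled $1,\dots,i$ form a Young diagram). The shapes of elements of $B_n$ are $(n+k,n-k)$ with $0\le k\le n$. *)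

(* Defs.v *)
From mathcomp Require Import all_boot.
From mathcomp Require Import all_classical.

Set Implicit Arguments.
Unset Strict Implicit.
Unset Printing Implicit Defensive.

Local Open Scope classical_set_scope.

(* Boxes are pairs (row, column), both counted from 0, in English convention. *)
Definition box : Type := (nat * nat)%type.

(* The empty rows are left out, so that a partition is a unique sequence. *)
Definition is_partition (m : nat) (sh : seq nat) : Prop :=
  [/\ sorted geq sh, 0 \notin sh & sumn sh = m].

Definition young_diagram (sh : seq nat) : set box :=
  [set b | b.2 < nth 0 sh b.1].

(* The arguments are the row and column of the upper-left box of the domino. *)
Inductive domino : Type :=
| Horizontal of nat & nat
| Vertical of nat & nat.

Definition domino_boxes (d : domino) : set box :=
  match d with
  | Horizontal r c => [set (r, c); (r, c.+1)]
  | Vertical r c => [set (r, c); (r.+1, c)]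
  end.

Definition horizontal_in_first_row (d : domino) : bool :=
  if d is Horizontal 0 _ then true else false.

(* The labels 1, ..., n are encoded by 'I_n, the index i standing for the label
   i.+1; [tnth (dominoes T) i] is the domino that carries this label. *)
Record labeled_dominoes (n : nat) : Type := LabeledDominoes {
  diagram_shape : seq nat;
  dominoes : n.-tuple domino
}.

Definition domino_of_label (n : nat) (T : labeled_dominoes n) (i : 'I_n) :
  set box := domino_boxes (tnth (dominoes T) i).

Definition is_domino_diagram (n : nat) (T : labeled_dominoes n) : Prop :=
  [/\ is_partition n.*2 (diagram_shape T),
      trivIset [set: 'I_n] (domino_of_label T) &
      \bigcup_i domino_of_label T i = young_diagram (diagram_shape T)].

(* The conclusions are weak inequalities because two boxes of the same row or
   column may belong to the same domino. *)
Definition rows_increase (n : nat) (T : labeled_dominoes n) : Prop :=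
  forall (i j : 'I_n) (r c c' : nat),
    domino_of_label T i (r, c) -> domino_of_label T j (r, c') ->
    c < c' -> i <= j.

Definition columns_increase (n : nat) (T : labeled_dominoes n) : Prop :=
  forall (i j : 'I_n) (r r' c : nat),
    domino_of_label T i (r, c) -> domino_of_label T j (r', c) ->
    r < r' -> i <= j.

Definition is_SDT (n : nat) (T : labeled_dominoes n) : Prop :=
  [/\ is_domino_diagram T, rows_increase T & columns_increase T].

Definition two_row_SDT (n : nat) : set (labeled_dominoes n) :=
  [set T | is_SDT T /\ size (diagram_shape T) <= 2].
Arguments two_row_SDT n : clear implicits.

Definition first_row_labels (n : nat) (T : labeled_dominoes n) : {set 'I_n} :=
  [set i | horizontal_in_first_row (tnth (dominoes T) i)]%SET.

(* Main.v *)
Require Import Defs.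
From mathcomp Require Import all_boot.
From mathcomp Require Import all_classical.
From mathcomp Require Import zify.

(** A shape with two rows of lengths [a >= b], where [a + b] is even, can be
    extended by a domino in exactly two ways: by a horizontal domino in the
    first row, or else by a vertical domino if [a = b] and by a horizontal
    domino in the second row if [a >= b + 2].  Hence a two-row tableau, grown
    label by label, amounts to a sequence of [n] free binary choices, recorded
    by the set of labels of the horizontal dominoes in the first row. *)

Set Implicit Arguments.
Unset Strict Implicit.
Unset Printing Implicit Defensive.

Local Open Scope classical_set_scope.
Local Open Scope card_scope.

(** * Row lengths of a Young diagram *)

Lemma young_diagram_inj (sh sh' : seq nat) :
  young_diagram sh = young_diagram sh' -> nth 0 sh =1 nth 0 sh'.
Proof.
move=> E r; apply/eqP; rewrite eqn_leq.
have H c : (c < nth 0 sh r) = (c < nth 0 sh' r).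
  have := congr1 (fun X : set box => X (r, c)) E.
  by rewrite /young_diagram /= => /is_true_inj.
(* Each inequality is [H] at the column whose index is the other row length. *)
by rewrite !(leqNgt (nth _ _ _)) -H ltnn H ltnn.
Qed.

Lemma nth_sorted_geq (sh : seq nat) (r r' : nat) :
  sorted geq sh -> r <= r' -> nth 0 sh r' <= nth 0 sh r.
Proof.
move=> sorted_sh ler; have [ge|lt] := leqP (size sh) r'.
  by rewrite nth_default.
have geq_trans : transitive geq by move=> y x z; rewrite /geq /= => ? /leq_trans; apply.
have geq_refl : reflexive geq by move=> x; apply: leqnn.
by apply: (sorted_leq_nth geq_trans geq_refl 0 sorted_sh) => //; apply: leq_ltn_trans lt.
Qed.

(** * Growth of a two-row diagram under a sequence of choices *)

Section Growth.

(* [s i] tells whether the domino with index [i] lies horizontally in the first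
   row. *)
Variable s : nat -> bool.

Fixpoint row_lengths (i : nat) : nat * nat :=
  if i is j.+1 then
    let: (a, b) := row_lengths j in
    if s j then (a.+2, b) else if a == b then (a.+1, b.+1) else (a, b.+2)
  else (0, 0).

Definition next_domino (i : nat) : domino :=
  let: (a, b) := row_lengths i in
  if s i then Horizontal 0 a
  else if a == b then Vertical 0 a else Horizontal 1 b.

Definition growing_diagram (i : nat) : set box :=
  young_diagram [:: (row_lengths i).1; (row_lengths i).2].

Lemma row_lengths_sum (i : nat) :
  (row_lengths i).1 + (row_lengths i).2 = i.*2.
Proof.
elim: i => //= i; case: (row_lengths i) => a b /=.
by case: (s i) => /=; last case: eqP => /=; lia.
Qed.

(** By [row_lengths_sum] the two lengths have the same parity, so unequal lengths differ by at least
    2, which leaves room for a horizontal domino in the second row. *)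
Lemma row_lengths_le (i : nat) : (row_lengths i).2 <= (row_lengths i).1.
Proof.
elim: i => //= i; have := row_lengths_sum i.
case: (row_lengths i) => a b /=.
by case: (s i) => /=; last case: eqP => /=; lia.
Qed.

(** With dominoes seen as differences of consecutive diagrams, disjointness and monotonicity of
    labels follow from the nesting of the diagrams alone. *)
Lemma next_domino_boxes (i : nat) (b : box) :
  domino_boxes (next_domino i) b <->
  growing_diagram i.+1 b /\ ~ growing_diagram i b.
Proof.
have := row_lengths_sum i; have := row_lengths_le i.
rewrite /next_domino /growing_diagram /young_diagram /=.
case: (row_lengths i) => x y /= lexy sumxy.
case: b => [[|[|r]] c]; (case: (s i) => /=; last case: eqP => /= ?);
  rewrite ?nth_nil; split=> [[]|] ; rewrite ?pair_equal_spec; lia.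
Qed.

Lemma growing_diagramS (i : nat) :
  growing_diagram i.+1 = growing_diagram i `|` domino_boxes (next_domino i).
Proof.
apply/seteqP; split=> b; last first.
  case=> [|/next_domino_boxes[]//].
  rewrite /growing_diagram /young_diagram /=.
  case: (row_lengths i) => x y.
  by case: b => [[|[|r]] c]; case: (s i) => //=; case: (x =P y) => //= ?; lia.
by move=> ib; have [|nib] := pselect (growing_diagram i b);
  [left | right; apply/next_domino_boxes].
Qed.

Lemma growing_diagram_mono (i j : nat) :
  i <= j -> growing_diagram i `<=` growing_diagram j.
Proof.
elim: j => [|j IH]; first by rewrite leqn0 => /eqP ->.
rewrite leq_eqVlt => /predU1P[-> //|/IH ij] b /ij jb.
by rewrite growing_diagramS; left.
Qed.

Lemma growing_diagram_row (i r c c' : nat) :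
  c < c' -> growing_diagram i (r, c') -> growing_diagram i (r, c).
Proof. exact: ltn_trans. Qed.

Lemma growing_diagram_column (i r r' c : nat) :
  r < r' -> growing_diagram i (r', c) -> growing_diagram i (r, c).
Proof.
have := row_lengths_le i; rewrite /growing_diagram /young_diagram /=.
by case: r r' => [|[|r]] [|[|r']] //=; rewrite ?nth_nil //; lia.
Qed.

(** The hypotheses are what a two-row tableau guarantees about the domino [d] that follows the first
    [i] ones. They force [d] to start exactly where its rows end, and the last one selects between
    the two possible extensions. *)
Lemma eq_next_domino (i : nat) (d : domino) :
  (forall b, domino_boxes d b -> ~ growing_diagram i b /\ b.1 < 2) ->
  (forall r c c', c < c' -> domino_boxes d (r, c') ->
    growing_diagram i (r, c) \/ domino_boxes d (r, c)) ->
  (forall r r' c, r < r' -> domino_boxes d (r', c) ->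
    growing_diagram i (r, c) \/ domino_boxes d (r, c)) ->
  horizontal_in_first_row d = s i -> d = next_domino i.
Proof.
have := row_lengths_le i; rewrite /next_domino /growing_diagram /young_diagram.
case: (row_lengths i) => x y /= lexy.
case: d => r c new row col /= <-.
- have [nrc ltr2] := new (r, c) (or_introl erefl).
  (* The left neighbour of the first box, if there is one, is outside the domino and hence already
     present, so [c] is the length of row [r]. The case [c = 0] is treated apart. *)
  have rowc := row r c.-1 c ^~ (or_introl erefl).
  case: r ltr2 new row col nrc rowc => [|[|//]] _ _ _ col /= nrc rowc.
    congr Horizontal; case: c {col} nrc rowc => [|c] /= nrc rowc; first by lia.
    by case: (rowc (ltnSn c)) => [|[][]]; lia.
  have -> : c = y.
    case: c {col} nrc rowc => [|c] /= nrc rowc; first by lia.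
    by case: (rowc (ltnSn c)) => [|[][]]; lia.
  (* The box above the right half is already present, so [y.+1 < x] and the rows are unequal. *)
  case: (col 0 1 c.+1 erefl (or_intror erefl)) => [|[]//] /=.
  by case: (x =P y) => //; lia.
- have [nrc ltr2] := new (r, c) (or_introl erefl).
  have [nrc' ltr2'] := new (r.+1, c) (or_intror erefl).
  have rowc := row r c.-1 c ^~ (or_introl erefl).
  have rowc' := row r.+1 c.-1 c ^~ (or_intror erefl).
  (* Both boxes lie in the first two rows, so [r = 0]; the left neighbours of both are already
     present, so both rows have length [c]. *)
  case: r {new row col} ltr2 ltr2' nrc nrc' rowc rowc' => [|//] _ _ /=.
  move=> nrc nrc' rowc rowc'; suff [-> ->] : x = c /\ y = c by rewrite eqxx.
  case: c nrc nrc' rowc rowc' => [|c] /= nrc nrc' rowc rowc'; first by lia.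
  by case: (rowc (ltnSn c)) => [|[][]]; case: (rowc' (ltnSn c)) => [|[][]]; lia.
Qed.

End Growth.

(** * Passing from a pair of row lengths to a partition without zero entries *)

Definition drop_empty_rows (a b : nat) : seq nat :=
  [seq x <- [:: a; b] | x != 0].

Lemma nth_drop_empty_rows (a b : nat) :
  b <= a -> nth 0 (drop_empty_rows a b) =1 nth 0 [:: a; b].
Proof. by case: a b => [|a] [|b] // _ [|[|[|r]]]. Qed.

Lemma eq_drop_empty_rows (a b : nat) (sh : seq nat) :
  0 \notin sh -> size sh <= 2 -> nth 0 sh =1 nth 0 [:: a; b] ->
  sh = drop_empty_rows a b.
Proof.
case: sh => [|x [|y [|//]]] /= + _ E; have /= <- := E 0; have /= <- := E 1 => //.
- by case: x {E}.
- by case: x y {E} => [|x] [|y].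
Qed.

(** * Two-row tableaux as tableaux grown from subsets *)

Section GrownTableau.

Variable n : nat.
Implicit Types (S : {set 'I_n}) (T : labeled_dominoes n).

Lemma eq_labeled_dominoes T T' :
  diagram_shape T = diagram_shape T' -> dominoes T = dominoes T' -> T = T'.
Proof. by case: T T' => [sh ds] [sh' ds'] /= -> ->. Qed.

(** Extended by [false] beyond [n], since the growth is a recursion over all natural numbers. *)
Definition choice_of_set S (i : nat) : bool := i \in [seq val j | j in S].

Lemma choice_of_setE S (i : 'I_n) : choice_of_set S i = (i \in S).
Proof. by rewrite /choice_of_set (fintype.mem_image val_inj). Qed.

Definition grown_tableau S : labeled_dominoes n :=
  let: (a, b) := row_lengths (choice_of_set S) n in
  LabeledDominoes (drop_empty_rows a b)
    [tuple next_domino (choice_of_set S) i | i < n].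

Lemma tnth_grown_tableau S (i : 'I_n) :
  tnth (dominoes (grown_tableau S)) i = next_domino (choice_of_set S) i.
Proof.
by rewrite /grown_tableau; case: row_lengths => a b; rewrite tnth_mktuple.
Qed.

Lemma grown_tableau_boxes S (i : 'I_n) (b : box) :
  domino_of_label (grown_tableau S) i b <->
  growing_diagram (choice_of_set S) i.+1 b /\
  ~ growing_diagram (choice_of_set S) i b.
Proof. by rewrite /domino_of_label tnth_grown_tableau next_domino_boxes. Qed.

Lemma grown_tableau_before S (i j : 'I_n) (b : box) :
  domino_of_label (grown_tableau S) i b -> i < j ->
  growing_diagram (choice_of_set S) j b.
Proof. by move=> /grown_tableau_boxes[ib _] /growing_diagram_mono; apply. Qed.

Lemma first_row_labels_grown_tableau S :
  first_row_labels (grown_tableau S) = S.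
Proof.
apply/setP => i; rewrite inE tnth_grown_tableau -choice_of_setE /next_domino.
case: row_lengths => a b; case: (choice_of_set S i) => //.
by case: (a == b).
Qed.

Lemma growing_diagram_cover (s : nat -> bool) (m : nat) (b : box) :
  growing_diagram s m b -> exists2 i, i < m & domino_boxes (next_domino s i) b.
Proof.
elim: m => [|m IH].
  by case: b => [[|[|r]] c]; rewrite /growing_diagram /young_diagram /= ?nth_nil.
rewrite growing_diagramS => -[/IH[i im ib]|mb]; first by exists i => //; exact: ltnW.
by exists m.
Qed.

Lemma grown_tableau_shape S :
  diagram_shape (grown_tableau S) =
  drop_empty_rows (row_lengths (choice_of_set S) n).1
                  (row_lengths (choice_of_set S) n).2.
Proof. by rewrite /grown_tableau; case: row_lengths. Qed.

Lemma young_diagram_grown_tableau S :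
  young_diagram (diagram_shape (grown_tableau S)) =
  growing_diagram (choice_of_set S) n.
Proof.
rewrite grown_tableau_shape /growing_diagram /young_diagram.
apply/seteqP; split=> b /=; rewrite nth_drop_empty_rows //; exact: row_lengths_le.
Qed.

(** The diagrams are nested and closed under moving left and up. An overlap or a wrong order of
    labels would thus put a box of the later domino into the diagram preceding it. *)
Lemma two_row_SDT_grown_tableau S : two_row_SDT n (grown_tableau S).
Proof.
split; last first.
  by rewrite grown_tableau_shape size_filter; apply: (leq_trans (count_size _ _)).
split; first split.
- rewrite grown_tableau_shape; move: (row_lengths_sum (choice_of_set S) n).
  move: (row_lengths_le (choice_of_set S) n); case: row_lengths => a b /=.
  move=> leba <-; split; last 1 first.
  + by case: a b {leba} => [|a] [|b] //=; rewrite ?addn0.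
  + by case: a b leba => [|a] [|b] //= leba; rewrite /geq /= leba.
  + by rewrite mem_filter.
- move=> i j _ _ [b [ib jb]].
  have [ltij|ltji|/val_inj //] := ltngtP i j; exfalso.
    have /grown_tableau_boxes[_ nj] := jb.
    exact/nj/(grown_tableau_before ib ltij).
  have /grown_tableau_boxes[_ ni] := ib.
  exact/ni/(grown_tableau_before jb ltji).
- rewrite young_diagram_grown_tableau; apply/seteqP; split=> b.
    case=> i _ /grown_tableau_boxes[ib _].
    exact: growing_diagram_mono (ltn_ord i) _ ib.
  case/growing_diagram_cover=> i ltin ib; exists (Ordinal ltin) => //.
  by rewrite /domino_of_label tnth_grown_tableau.
- move=> i j r c c' ib jb ltc; rewrite leqNgt; apply/negP => ltji.
  have /grown_tableau_boxes[_ ni] := ib.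
  exact/ni/(growing_diagram_row ltc)/(grown_tableau_before jb ltji).
- move=> i j r r' c ib jb ltr; rewrite leqNgt; apply/negP => ltji.
  have /grown_tableau_boxes[_ ni] := ib.
  exact/ni/(growing_diagram_column ltr)/(grown_tableau_before jb ltji).
Qed.

(** The tableau conditions leave no freedom beyond the choices recorded in [first_row_labels T], so
    the dominoes agree with the grown ones label by label. *)
Lemma two_row_SDT_grown T :
  two_row_SDT n T -> T = grown_tableau (first_row_labels T).
Proof.
move=> [[[[sorted_shape sh0 _] disj cover] rows columns] size2].
set s := choice_of_set (first_row_labels T).
(* As long as the labels below [m] follow the growth, they cover exactly the growing diagram at
   stage [m]. *)
have before m : m <= n ->
    (forall i : 'I_n, i < m -> tnth (dominoes T) i = next_domino s i) ->
  forall b, growing_diagram s m b <->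
    exists2 i : 'I_n, i < m & domino_of_label T i b.
  move=> lemn eqT b; split=> [/growing_diagram_cover[i ltim ib]|[i ltim]].
    exists (Ordinal (leq_trans ltim lemn)) => //.
    by rewrite /domino_of_label eqT.
  rewrite /domino_of_label eqT // => /next_domino_boxes[ib _].
  exact: growing_diagram_mono ltim _ ib.
have label_inj (i j : 'I_n) b :
  domino_of_label T i b -> domino_of_label T j b -> i = j.
  by move=> ib jb; apply: disj => //; exists b.
have labelled b : young_diagram (diagram_shape T) b ->
  exists i, domino_of_label T i b.
  by rewrite -cover => -[i _ ib]; exists i.
have in_shape i b : domino_of_label T i b -> young_diagram (diagram_shape T) b.
  by move=> ib; rewrite -cover; exists i.
have eqT (i : 'I_n) : tnth (dominoes T) i = next_domino s i.
  (* Strong induction on the label. *)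
  have [m] := ubnP i; elim: m i => // m IH i; rewrite ltnS => leim.
  have beforei := before i (ltnW (ltn_ord i)) (fun j lt => IH j (leq_trans lt leim)).
  (* Boxes to the left of or above domino [i] carry labels at most [i] by [rows] and [columns]; this
     puts them where [eq_next_domino] wants them. *)
  have earlier (j : 'I_n) b : domino_of_label T j b -> j <= i ->
      growing_diagram s i b \/ domino_boxes (tnth (dominoes T) i) b.
    move=> jb; rewrite leq_eqVlt => /predU1P[/val_inj <-|ltji]; first by right.
    by left; apply/beforei; exists j.
  apply: eq_next_domino.
  - move=> b ib; split.
      by move=> /beforei[j ltji jb]; rewrite (label_inj _ _ _ ib jb) ltnn in ltji.
    rewrite ltnNge; apply/negP => ge2; have := in_shape _ _ ib.
    by rewrite /young_diagram /= nth_default // (leq_trans size2).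
  - move=> r c c' ltc ib; have : young_diagram (diagram_shape T) (r, c).
      exact: ltn_trans ltc (in_shape _ _ ib).
    by case/labelled=> j jb; apply: (earlier j) => //; apply: rows jb ib ltc.
  - move=> r r' c ltr ib; have : young_diagram (diagram_shape T) (r, c).
      exact: leq_trans (in_shape _ _ ib) (nth_sorted_geq sorted_shape (ltnW ltr)).
    by case/labelled=> j jb; apply: (earlier j) => //; apply: columns jb ib ltr.
  - by rewrite /s choice_of_setE inE.
apply: eq_labeled_dominoes.
  rewrite grown_tableau_shape; apply: eq_drop_empty_rows => //.
  (* At [m = n], [before] identifies the union of all dominoes of [T] with the final growing
     diagram. *)
  apply: young_diagram_inj; rewrite -cover; apply/seteqP; split=> b.
    by case=> i _ ib; apply/(before n) => //; exists i.
  by move/(before n (leqnn n) (fun i _ => eqT i)) => [i _ ib]; exists i.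
by apply: eq_from_tnth => i; rewrite tnth_grown_tableau eqT.
Qed.

End GrownTableau.

Theorem theorem2p3 (n : nat) (hn : 1 <= n) :
  [/\ set_bij (two_row_SDT n) [set: {set 'I_n}] (@first_row_labels n),
      forall T T' : labeled_dominoes n, two_row_SDT n T -> two_row_SDT n T' ->
        first_row_labels T = first_row_labels T' -> T = T' &
      forall k : nat, k <= n ->
        [set T : labeled_dominoes n |
          two_row_SDT n T /\ #|first_row_labels T| = k] #= `I_('C(n, k))].
Proof.
have inj T T' : two_row_SDT n T -> two_row_SDT n T' ->
    first_row_labels T = first_row_labels T' -> T = T'.
  by move=> /two_row_SDT_grown {2}-> /two_row_SDT_grown {2}-> ->.
split=> //.
  split=> // [T T' /[!inE]|S _]; first exact: inj.
  exists (grown_tableau S); first exact: two_row_SDT_grown_tableau.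
  exact: first_row_labels_grown_tableau.
move=> k _; pose sets := enum [set A : {set 'I_n} | #|A| == k]%SET.
have size_sets : size sets = 'C(n, k).
  by rewrite -cardE card_draws card_ord.
have in_sets A : (A \in sets) = (#|A| == k) by rewrite mem_enum inE.
(* Numbering the tableaux by the position of their label set in the list of [k]-subsets gives a
   bijection onto an initial segment of the natural numbers. *)
pose rank (T : labeled_dominoes n) := index (first_row_labels T) sets.
rewrite -size_sets.
have <- : rank @` [set T | two_row_SDT n T /\ #|first_row_labels T| = k]
  = `I_(size sets).
  apply/seteqP; split=> [_ [T [_ cardT] <-]|i /= lti].
    by rewrite /= index_mem in_sets cardT.
  exists (grown_tableau (nth finset.set0 sets i)).
    split; first exact: two_row_SDT_grown_tableau.
    by apply/eqP; rewrite first_row_labels_grown_tableau -in_sets mem_nth.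
  by rewrite /rank first_row_labels_grown_tableau index_uniq ?enum_uniq.
rewrite card_eq_sym; apply: inj_card_eq => T T' /[!inE] -[TT cardT] [TT' cardT'].
move=> /(congr1 (nth finset.set0 sets)); rewrite !nth_index ?in_sets ?cardT ?cardT' //.
exact: inj.
Qed.
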